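(* Let $X_\lambda$ be a cellular multipointed $d$-space. A continuous map $[0,1]\to|X_\lambda|$ is a directed path of $\vec{\mathrm{Sp}}(X_\lambda)$ if and only if it is of the form $\gamma\phi$ where $\gamma$ is an execution path of $X_\lambda$ or a constant path, and $\phi\in\mathcal{I}(1)$.
   Context: $\mathcal{M}(\ell,\ell')$: non-decreasing surjective continuous maps $[0,\ell]\to[0,\ell']$; $\mathcal{I}(\ell)$: non-decreasing continuous maps $[0,1]\to[0,\ell]$ (constants allowed); $\mu_\ell(t)=t/\ell$ for $\ell>0$. Moore composition $*$ concatenates a path $[0,\ell_1]\to U$ and a path $[0,\ell_2]\to U$ into a path $[0,\ell_1+\ell_2]\to U$; normalized composition of $\gamma_1,\gamma_2:[0,1]\to U$ is $(\gamma_1\mu_{1/2})*(\gamma_2\mu_{1/2})$. A multipointed $d$-space is $(|X|,X^0,\mathbb{P}^{\mathrm{top}}X)$: a space, a set of states $X^0\subset|X|$, a set of continuous maps $[0,1]\to|X|$ (execution paths) with endpoints in $X^0$, closed under precomposition by $\mathcal{M}(1,1)$ and normalized composition. $\vec{\mathrm{Sp}}(X)$ is the directed space with underlying space $|X|$ whose directed paths are all constant paths and all Moore compositions $(\gamma_1\phi_1\mu_{\ell_1})*\dots*(\gamma_n\phi_n\mu_{\ell_n})$ with $n\ge1$, $\ell_i>0$, $\sum\ell_i=1$, $\gamma_i$ execution paths of $X$, $\phi_i\in\mathcal{I}(1)$. For a space $Z$, $\mathrm{Glob}^{\mathrm{top}}(Z)$ is the multipointed $d$-space with underlying space the quotient of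 $\{0,1\}\sqcup Z\times[0,1]$ by $(z,0)\sim0$, $(z,1)\sim1$, states $\{0,1\}$, execution paths $\delta_z\phi$ ($z\in Z$, $\phi\in\mathcal{M}(1,1)$, $\delta_z(t)=(z,t)$). $\mathbf{D}^n$, $\mathbf{S}^{n-1}$: closed $n$-disk and its boundary ($\mathbf{D}^0$ a point, $\mathbf{S}^{-1}=\varnothing$). A cellular multipointed $d$-space is $X_\lambda=\varinjlim_{\nu<\lambda}X_\nu$ for a colimit-preserving functor $\nu\mapsto X_\nu$ on an ordinal $\lambda$ with $X_0=(X^0,X^0,\varnothing)$ and each $X_\nu\to X_{\nu+1}$ a pushout of $\mathrm{Glob}^{\mathrm{top}}(\mathbf{S}^{n_\nu-1})\to\mathrm{Glob}^{\mathrm{top}}(\mathbf{D}^{n_\nu})$ (induced by inclusion) along some $g_\nu$, $n_\nu\ge0$. *)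

(* Defs.v *)
From HB Require Import structures.
From mathcomp Require Import all_boot all_order all_algebra.
From mathcomp Require Import all_classical all_reals.
From mathcomp Require Import topology normedtype.
From mathcomp Require Import Rstruct Rstruct_topology.
From Stdlib Require Import Rdefinitions.

Set Implicit Arguments.
Unset Strict Implicit.
Unset Printing Implicit Defensive.

Import Order.TTheory GRing.Theory Num.Theory.
Local Open Scope classical_set_scope.
Local Open Scope ring_scope.

Definition RR : realType := Rdefinitions.R.

Definition Iu_set : set RR := [set t | 0 <= t <= 1].
Definition Iu : topologicalType := Iu_set.

Definition in_I1 (phi : Iu -> Iu) : Prop :=
  continuous phi /\ (forall s t : Iu, val s <= val t -> val (phi s) <= val (phi t)).

Definition in_M11 (phi : Iu -> Iu) : Prop :=
  in_I1 phi /\ (forall u : Iu, exists t : Iu, phi t = u).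

(** [delta] is the normalized composition (g1 mu_{1/2}) * (g2 mu_{1/2}) of g1 and g2.
    (Such a [delta] exists iff g1(1) = g2(0), and it is then unique.) *)
Definition normcomp (T : Type) (g1 g2 delta : Iu -> T) : Prop :=
  forall t s : Iu,
    (val t <= 1/2 -> val s = 2 * val t -> delta t = g1 s) /\
    (1/2 <= val t -> val s = 2 * val t - 1 -> delta t = g2 s).

Record mds := MDS {
  mcar :> topologicalType;
  mstates : set mcar;
  mpaths : set (Iu -> mcar) }.
Arguments mstates : clear implicits.
Arguments mpaths : clear implicits.

Definition is_mds (X : mds) : Prop :=
  (forall g, mpaths X g ->
     continuous g /\ (forall t : Iu, val t = 0 \/ val t = 1 -> mstates X (g t))) /\
  (forall g phi, mpaths X g -> in_M11 phi -> mpaths X (g \o phi)) /\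
  (forall g1 g2 delta, mpaths X g1 -> mpaths X g2 -> normcomp g1 g2 delta ->
     mpaths X delta).

Definition mor (X Y : mds) (f : X -> Y) : Prop :=
  continuous f /\ (forall x, mstates X x -> mstates Y (f x)) /\
  (forall g, mpaths X g -> mpaths Y (f \o g)).

Definition is_pushout (A B C D : mds) (f : A -> B) (g : A -> C) (h : B -> D)
    (k : C -> D) : Prop :=
  mor f /\ mor g /\ mor h /\ mor k /\ h \o f = k \o g /\
  forall (Y : mds), is_mds Y -> forall (u : B -> Y) (v : C -> Y),
    mor u -> mor v -> u \o f = v \o g ->
    exists w : D -> Y, mor w /\ w \o h = u /\ w \o k = v /\
      forall w' : D -> Y, mor w' -> w' \o h = u -> w' \o k = v -> w' = w.

Record wo := WO {
  wcar :> Type;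
  wlt : wcar -> wcar -> Prop;
  wlt_trans : forall a b c, wlt a b -> wlt b c -> wlt a c;
  wlt_total : forall a b, wlt a b \/ a = b \/ wlt b a;
  wlt_wf : well_founded wlt }.

Definition wle (W : wo) (a b : W) : Prop := wlt a b \/ a = b.

Definition is_colim (W : wo) (P : W -> Prop) (Xs : W -> mds)
    (f : forall m n : W, Xs m -> Xs n) (Z : mds) (c : forall n : W, Xs n -> Z) : Prop :=
  (forall n, P n -> mor (c n)) /\
  (forall m n, P m -> P n -> wle m n -> c n \o f m n = c m) /\
  forall (Y : mds), is_mds Y -> forall (d : forall n : W, Xs n -> Y),
    (forall n, P n -> mor (d n)) ->
    (forall m n, P m -> P n -> wle m n -> d n \o f m n = d m) ->
    exists w : Z -> Y, mor w /\ (forall n, P n -> w \o c n = d n) /\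
      forall w' : Z -> Y, mor w' -> (forall n, P n -> w' \o c n = d n) -> w' = w.

(** Glob^top(Z).  The underlying set of the quotient of {0,1} + Z x [0,1]
    by (z,0) ~ 0, (z,1) ~ 1 is represented by canonical representatives:
    the two states and the points (z,t) with 0 < t < 1. *)
Definition mid_set : set RR := [set t | 0 < t < 1].

Inductive glob_pt (Z : Type) : Type :=
| G0 | G1 | Gm of Z & mid_set.
Arguments G0 {Z}. Arguments G1 {Z}.

Definition gdelta (Z : Type) (z : Z) (t : Iu) : glob_pt Z :=
  match (insub (val t) : option mid_set) with
  | Some s => Gm z s
  | None => if val t == 0 then G0 else G1
  end.

Definition glob_top (Z : topologicalType) : Type := glob_pt Z.
HB.instance Definition _ (Z : topologicalType) := gen_eqMixin (glob_top Z).
HB.instance Definition _ (Z : topologicalType) := gen_choiceMixin (glob_top Z).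

(** The quotient map  Z x [0,1] -> Glob(Z)  (the summand {0,1} is discrete). *)
Definition gquot (Z : topologicalType) (p : Z * Iu) : glob_top Z :=
  gdelta p.1 p.2.

Definition glob_open (Z : topologicalType) (U : set (glob_top Z)) : Prop :=
  open (@gquot Z @^-1` U).

Lemma glob_openT (Z : topologicalType) : glob_open (@setT (glob_top Z)).
Proof. by rewrite /glob_open preimage_setT; exact: openT. Qed.

Lemma glob_openI (Z : topologicalType) : setI_closed (@glob_open Z).
Proof. by move=> A B oA oB; rewrite /glob_open preimage_setI; exact: openI. Qed.

Lemma glob_open_bigU (Z : topologicalType) (I : Type) (F : I -> set (glob_top Z)) :
  (forall i, glob_open (F i)) -> glob_open (\bigcup_i F i).
Proof.
by move=> oF; rewrite /glob_open preimage_bigcup; apply: bigcup_open => i _; exact: oF.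
Qed.

HB.instance Definition _ (Z : topologicalType) :=
  isOpenTopological.Build (glob_top Z) (@glob_openT Z) (@glob_openI Z)
    (@glob_open_bigU Z).

Definition Glob (Z : topologicalType) : mds :=
  @MDS (glob_top Z) [set x | x = G0 \/ x = G1]
       [set d | exists (z : Z) (phi : Iu -> Iu), in_M11 phi /\ d = gdelta z \o phi].

Definition glob_map (Z Z' : topologicalType) (u : Z -> Z') (x : Glob Z) : Glob Z' :=
  match x with G0 => G0 | G1 => G1 | Gm z t => Gm (u z) t end.

(** Closed n-disk D^n and its boundary S^{n-1} in R^n (Euclidean norm). *)
Definition sqnorm n (x : 'rV[RR]_n) : RR := \sum_(i < n) x ord0 i ^+ 2.
Definition disk_set n : set 'rV[RR]_n := [set x | sqnorm x <= 1].
Definition sphere_set n : set 'rV[RR]_n := [set x | sqnorm x = 1].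
Definition Disk (n : nat) : topologicalType := @disk_set n.
Definition Sphere (n : nat) : topologicalType := @sphere_set n.

Lemma sphere_sub_disk n (x : Sphere n) : val x \in @disk_set n.
Proof.
case: x => x /= /set_mem hx; apply/mem_set; rewrite /disk_set /= hx //.
Qed.

Definition sph_incl n (x : Sphere n) : Disk n := exist _ (val x) (sphere_sub_disk x).

Definition glob_incl n : Glob (Sphere n) -> Glob (Disk n) := glob_map (@sph_incl n).

(** Cellular multipointed d-spaces. The ordinal lambda is the well-ordered set
    W = {nu | nu < lambda}; X = X_lambda is the colimit of the whole chain. *)
Definition is_limit_idx (W : wo) (n : W) : Prop :=
  (exists m, wlt m n) /\ (forall m, wlt m n -> exists p, wlt m p /\ wlt p n).
Definition is_succ_idx (W : wo) (n n' : W) : Prop :=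
  wlt n n' /\ forall p, ~ (wlt n p /\ wlt p n').

Definition cellular (X : mds) : Prop :=
  exists (W : wo) (Xs : W -> mds) (f : forall m n : W, Xs m -> Xs n)
         (c : forall n : W, Xs n -> X),
    is_mds X /\ (forall n, is_mds (Xs n)) /\
    (forall m n, wle m n -> mor (f m n)) /\
    (forall n, f n n = id) /\
    (forall m n p, wle m n -> wle n p -> f n p \o f m n = f m p) /\
    is_colim (fun _ => True) f c /\
    (forall n, is_limit_idx n -> is_colim (fun m => wlt m n) f (fun m => f m n)) /\
    (forall n, (forall m, ~ wlt m n) ->
       (forall A : set (Xs n), open A) /\ mstates (Xs n) = setT /\
       mpaths (Xs n) = set0) /\
    (forall n n', is_succ_idx n n' ->
       exists (k : nat) (g : Glob (Sphere k) -> Xs n) (h : Glob (Disk k) -> Xs n'),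
         is_pushout (@glob_incl k) g h (f n n')).

(** Directed paths of the directed space Sp(X): constant paths and Moore
    compositions (g_1 phi_1 mu_{l_1}) * ... * (g_k phi_k mu_{l_k}), with
    l_i > 0, sum l_i = 1.  The i-th piece covers [L_i, L_i + l_i] with
    L_i = l_0 + ... + l_{i-1}. *)
Definition Sp_dpath (X : mds) (d : Iu -> X) : Prop :=
  (exists x : X, d = fun _ => x) \/
  exists (k : nat) (l : nat -> RR) (g : nat -> Iu -> X) (phi : nat -> Iu -> Iu),
    (0 < k)%nat /\ (forall i, (i < k)%nat -> 0 < l i) /\ \sum_(i < k) l i = 1 /\
    (forall i, (i < k)%nat -> mpaths X (g i) /\ in_I1 (phi i)) /\
    forall i, (i < k)%nat -> forall t s : Iu,
      \sum_(j < i) l j <= val t <= \sum_(j < i) l j + l i ->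
      val s = (val t - \sum_(j < i) l j) / l i ->
      d t = g i (phi i s).

(* Main.v *)
(** Every point of a cellular multipointed d-space is either a state coming from
    [X_0] or lies on a unique open arc [c h delta_z], with [z] in the interior of
    a disk, at a unique time. A path following a finite chain of such arcs through
    a monotone reparametrization can therefore be glued to another such path
    ending where it begins: both chains are cut at the arc containing the common
    point, and the parameters agree there up to an integer translation.

    That all execution paths follow chains of arcs comes from the universal
    properties: keeping only the execution paths of [X] that do so defines a
    multipointed d-space [X'] on the same topological space. By transfinite
    induction all maps [X_nu -> X] are morphisms to [X'], so the identity of [X] is
    a morphism to [X'] as well. Conversely, a chain of arcs is, up to
    reparametrization, an iterated normalized composition, hence an execution
    path. *)

Require Import Defs.
From HB Require Import structures.
From mathcomp Require Import all_boot all_order all_algebra.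
From mathcomp Require Import all_classical all_reals.
From mathcomp Require Import topology normedtype.
From mathcomp Require Import Rstruct Rstruct_topology.
From mathcomp Require Import ring lra zify.

Set Implicit Arguments.
Unset Strict Implicit.
Unset Printing Implicit Defensive.

Import Order.TTheory GRing.Theory Num.Theory.
Import numFieldNormedType.Exports.
Local Open Scope classical_set_scope.
Local Open Scope ring_scope.

(** * Chains of arcs *)

(** All that gluing needs from the cells: vertices in [S] and disjoint, injectively parametrized
    open arcs. Arcs are defined on the whole line, but only their values on [[0, 1]] are
    constrained. *)
Definition arc_family (R : realType) (T : Type) (S : set T) (E : set (R -> T)) : Prop :=
  (forall e, E e -> [/\ S (e 0), S (e 1) & forall t, 0 < t < 1 -> ~ S (e t)]) /\
  (forall e e' t t', E e -> E e' -> 0 < t < 1 -> 0 < t' < 1 -> e t = e' t' ->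
     e = e' /\ t = t').

Definition chain (R : realType) (T : Type) (E : set (R -> T)) (m : nat)
    (e : nat -> R -> T) : Prop :=
  (forall i, (i < m)%N -> E (e i)) /\
  (forall i, (i.+1 < m)%N -> e i 1 = e i.+1 0).

(** Parametrizations live on the whole line, so that their continuity never refers to a subspace. *)
Definition reparam (R : realType) (m : R) (p : R -> R) : Prop :=
  [/\ continuous p, {homo p : x y / x <= y} & forall x, 0 <= p x <= m].

(** At an integer value of [p t] two consecutive indices can be admissible; the formula is demanded
    for both, which is consistent on a chain. *)
Definition follows (R : realType) (T : Type) (m : nat) (e : nat -> R -> T)
    (p : R -> R) (D : R -> T) (a b : R) : Prop :=
  forall t i, a <= t <= b -> (i < m)%N -> 0 <= p t - i%:R <= 1 ->
    D t = e i (p t - i%:R).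

Definition traces (R : realType) (T : Type) (E : set (R -> T)) (D : R -> T)
    (a b : R) : Prop :=
  exists m e p, [/\ (0 < m)%N, chain E m e, reparam m%:R p & follows m e p D a b].

Lemma ex_unit_interval (R : realType) (m : nat) (x : R) :
  (0 < m)%N -> 0 <= x <= m%:R -> exists2 i, (i < m)%N & 0 <= x - i%:R <= 1.
Proof.
case: m => // m _; elim: m => [|m IH] /andP[x0 xm]; first by exists 0%N => //; lra.
have [xle|xgt] := leP x m.+1%:R.
  by have [|i im hi] := IH _; [rewrite x0 | exists i => //; exact: ltnW].
by exists m.+1 => //; move: xm; rewrite -(natr1 m.+1); lra.
Qed.

Lemma follows_eq (R : realType) (T : Type) m (e : nat -> R -> T) p D a b t u :
  (0 < m)%N -> reparam m%:R p -> follows m e p D a b ->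
  a <= t <= b -> a <= u <= b -> p t = p u -> D t = D u.
Proof.
move=> m0 [_ _ pm] fol ht hu eq_p.
have [i im hi] := ex_unit_interval m0 (pm t).
by rewrite (fol t i) // (fol u i) // -eq_p.
Qed.

Lemma traces_eq (R : realType) (T : Type) (E : set (R -> T)) D D' (a b : R) :
  (forall t, a <= t <= b -> D t = D' t) -> traces E D a b -> traces E D' a b.
Proof.
move=> eqD [m [e [p [m0 ch rp fol]]]]; exists m, e, p; split=> // t i ht im hi.
by rewrite -eqD //; exact: fol.
Qed.

Lemma traces_comp (R : realType) (T : Type) (E : set (R -> T)) D (q : R -> R)
    (a b a' b' : R) :
  continuous q -> {homo q : x y / x <= y} ->
  (forall t, a' <= t <= b' -> a <= q t <= b) ->
  traces E D a b -> traces E (D \o q) a' b'.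
Proof.
move=> cq mq hq [m [e [p [m0 ch [cp mp pm] fol]]]].
exists m, e, (p \o q); split=> //.
- split=> [x|x y xy|x]; last exact: pm.
    by apply: continuous_comp; [exact: cq|exact: cp].
  exact/mp/mq.
- by move=> t i ht im hi; apply: fol => //; exact: hq.
Qed.

Lemma traces_arc (R : realType) (T : Type) (E : set (R -> T)) e (p : R -> R) (a b : R) :
  E e -> reparam 1 p -> traces E (e \o p) a b.
Proof.
move=> Ee rp; exists 1%N, (fun=> e), p; split=> //.
by move=> t [|//] _ _ _ /=; rewrite subr0.
Qed.

(** The formula is [p1] before [b] and [p2], shifted to start at [p1 b], after [b]. Written with
    [min] and [max], it is continuous without pasting two closed pieces. *)
Lemma continuous_join (R : realType) (p1 p2 : R -> R) (b : R) :
  continuous p1 -> continuous p2 ->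
  continuous (fun x => p1 (Num.min x b) + (p2 (Num.max x b) - p2 b)).
Proof.
move=> c1 c2 x; apply: cvgD; last apply: cvgB; last exact: cvg_cst.
- apply: (@continuous_comp _ _ _ (fun x => Num.min x b) p1); last exact: c1.
  by apply: continuous_min => //; exact: cvg_cst.
- apply: (@continuous_comp _ _ _ (fun x => Num.max x b) p2); last exact: c2.
  by apply: continuous_max => //; exact: cvg_cst.
Qed.

Lemma nondecreasing_join (R : realType) (p1 p2 : R -> R) (b : R) :
  {homo p1 : x y / x <= y} -> {homo p2 : x y / x <= y} ->
  {homo (fun x => p1 (Num.min x b) + (p2 (Num.max x b) - p2 b)) : x y / x <= y}.
Proof.
move=> m1 m2 x y xy; rewrite lerD // ?lerB //.
- by apply: m1; rewrite le_min !ge_min xy lexx orbT.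
- by apply: m2; rewrite ge_max !le_max xy lexx orbT.
Qed.

(* [D] follows the word [e1 0 ... e1 (I-1)] and then [e2 J ... e2 (m2-1)]:
   the two words are cut at the beginning of the arc containing the common
   point [D b], and the second parametrization is translated by [I - J]. *)
Lemma traces_splice (R : realType) (T : Type) (E : set (R -> T)) D (a b c : R)
    m1 m2 e1 e2 p1 p2 I J :
  (0 < m1)%N -> chain E m1 e1 -> reparam m1%:R p1 -> follows m1 e1 p1 D a b ->
  (0 < m2)%N -> chain E m2 e2 -> reparam m2%:R p2 -> follows m2 e2 p2 D b c ->
  a <= b <= c -> (I <= m1)%N -> (J <= m2)%N -> p1 b - I%:R = p2 b - J%:R ->
  p1 b = I%:R /\ (0 < I)%N \/
    [/\ 0 < p1 b - I%:R < 1, (I < m1)%N, (J < m2)%N & e1 I = e2 J] ->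
  traces E D a c.
Proof.
move=> m10 [E1 ch1] [c1 h1 b1] f1 m20 [E2 ch2] [c2 h2 b2] f2 /andP[ab bc] Im Jm eqr cs.
have hb : a <= b <= b by rewrite ab lexx.
have hb' : b <= b <= c by rewrite bc lexx.
(* When the cut is at a vertex, [D b] is the end of the last arc kept from the first word and the
   start of the first arc kept from the second. *)
have DbI : p1 b = I%:R -> (0 < I)%N -> D b = e1 I.-1 1.
  move=> pI I0; have eI : I.-1.+1 = I by rewrite prednK.
  have e11 : 1 = p1 b - I.-1%:R by rewrite pI -[X in X%:R - _]eI -natr1; ring.
  by rewrite [in RHS]e11; apply: f1 => //; [lia|rewrite -e11; lra].
have DbJ : p1 b = I%:R -> (J < m2)%N -> D b = e2 J 0.
  move=> pI Jl; have e0 : 0 = p2 b - J%:R by lra.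
  by rewrite [in RHS]e0; apply: f2 => //; rewrite -e0; lra.
pose e q := if (q < I)%N then e1 q else e2 (q - I + J)%N.
have eI r : e (I + r)%N = e2 (r + J)%N by rewrite /e ltnNge leq_addr /= addKn.
have el q : (q < I)%N -> e q = e1 q by rewrite /e => ->.
exists (I + (m2 - J))%N, e, (fun x => p1 (Num.min x b) + (p2 (Num.max x b) - p2 b)).
split.
- by case: cs => [[_ ?]|[_ _ ? _]]; lia.
- split=> [i|i] im.
    rewrite /e; case: ltnP => iI; first by apply: E1; lia.
    by apply: E2; lia.
  case: (ltngtP i.+1 I) => [iI|iI|iI].
  + by rewrite !el //; [apply: ch1; lia|lia].
  + have -> : i = (I + (i - I))%N by lia.
    by rewrite -addnS !eI addSn; apply: ch2; lia.
  + have -> : i.+1 = (I + 0)%N by lia.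
    rewrite eI add0n el; last by lia.
    (* At a vertex both sides are [D b]; inside an arc, [e2 J] is [e1 I], so the first chain still
       applies. *)
    case: cs => [[pI I0]|[_ I1 _ <-]]; last by rewrite -iI; apply: ch1; lia.
    by rewrite -DbJ //; [rewrite DbI // -iI|lia].
- split; [exact: continuous_join|exact: nondecreasing_join|] => x.
  have := b1 (Num.min x b); have := b2 (Num.max x b); have := b1 b.
  have : p1 (Num.min x b) <= p1 b by apply: h1; rewrite ge_min lexx orbT.
  have : p2 b <= p2 (Num.max x b) by apply: h2; rewrite le_max lexx orbT.
  rewrite natrD natrB //; lra.
- move=> t i /andP[at_ tc] im; have [tb|bt] := leP t b; last first.
  + rewrite (_ : p1 b + _ = p2 t - J%:R + I%:R); last lra.
    have htc : b <= t <= c by rewrite ltW.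
    have pbt : p2 b <= p2 t by apply: h2; exact: ltW.
    case: (ltnP i I) => [iI|Ii] hi.
      (* After time [b], an index below [I] is admissible only at the vertex [I] itself, with
         [i = I - 1], while the path still rests at [D b]. *)
      have iIR : i%:R + 1 <= I%:R :> R by rewrite natr1 ler_nat.
      case: cs => [[pI I0]|[rI _ _ _]]; last by exfalso; lra.
      have eqp : p2 t = p2 b by lra.
      have iIE : i = I.-1.
        apply/eqP; rewrite -eqSS prednK // eqn_leq iI /= -(ler_nat R) -natr1; lra.
      rewrite (_ : _ - i%:R = 1); last first.
        by rewrite iIE -[X in _ + X%:R]prednK // -natr1; lra.
      by rewrite el // iIE -DbI //; apply: (follows_eq m20 _ f2).
    move: hi; rewrite -[i](subnKC Ii) eI natrD => hi.
    rewrite (_ : _ - _ = p2 t - (i - I + J)%:R); last by rewrite natrD; ring.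
    apply: f2 => //; [lia|rewrite natrD; lra].
  + have htb : a <= t <= b by rewrite at_.
    have ptb : p1 t <= p1 b by exact: h1.
    rewrite subrr addr0; case: (ltnP i I) => [iI|Ii] hi.
      by rewrite el //; apply: f1 => //; lia.
    (* Symmetrically, an admissible index not below [I] up to time [b] is [I]: either the path
       already rests at the vertex [D b], or it runs in the common arc [e1 I = e2 J]. *)
    have iIR : I%:R <= i%:R :> R by rewrite ler_nat.
    case: cs => [[pI I0]|[rI Im1 Jm2 eIJ]].
      have eqp : p1 t = p1 b by lra.
      have iIE : i = I.
        by apply/eqP; rewrite eqn_leq Ii andbT -(ler_nat R); lra.
      rewrite eqp pI iIE subrr -[X in e X]addn0 eI add0n -DbJ //; last by lia.
      exact: (follows_eq m10 _ f1).
    have iIE : i = I.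
      apply/eqP; rewrite eqn_leq Ii andbT -ltnS -(ltr_nat R) -natr1; lra.
    by rewrite iIE -[X in e X]addn0 eI add0n -eIJ; apply: f1 => //; rewrite -iIE.
Qed.

(** Vertices lie in [S] and open arcs avoid [S], so [D b] is a vertex for both chains or interior to
    an arc of each. In the latter case [arc_family] makes the two arcs and the two times equal. *)
Lemma traces_glue (R : realType) (T : Type) (S : set T) (E : set (R -> T)) D (a b c : R) :
  arc_family S E -> a <= b <= c ->
  traces E D a b -> traces E D b c -> traces E D a c.
Proof.
move=> [ES Einj] /andP[ab bc].
move=> [m1 [e1 [p1 [m10 ch1 rp1 f1]]]] [m2 [e2 [p2 [m20 ch2 rp2 f2]]]].
have [E1 _] := ch1; have [E2 _] := ch2.
have [c1 h1 b1] := rp1; have [c2 h2 b2] := rp2.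
have hb : a <= b <= b by rewrite ab lexx.
have hb' : b <= b <= c by rewrite bc lexx.
have [i im hi] := ex_unit_interval m10 (b1 b).
have [j jm hj] := ex_unit_interval m20 (b2 b).
have abc : a <= b <= c by rewrite ab.
have Di := f1 b i hb im hi; have Dj := f2 b j hb' jm hj.
have [Si0 Si1 Sin] := ES _ (E1 i im); have [Sj0 Sj1 Sjn] := ES _ (E2 j jm).
have bdi : ~ 0 < p1 b - i%:R < 1 -> p1 b = i%:R \/ p1 b = i.+1%:R.
  rewrite -natr1 => ni; have [|n0] := eqVneq (p1 b) i%:R; first by left.
  by right; move: n0; rewrite neq_lt => /orP[]; lra.
have bdj : ~ 0 < p2 b - j%:R < 1 -> p2 b = j%:R \/ p2 b = j.+1%:R.
  rewrite -natr1 => ni; have [|n0] := eqVneq (p2 b) j%:R; first by left.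
  by right; move: n0; rewrite neq_lt => /orP[]; lra.
have [ii|/negP ni] := boolP (0 < p1 b - i%:R < 1);
  have [jj|/negP nj] := boolP (0 < p2 b - j%:R < 1).
- have [eqe eqt] := Einj _ _ _ _ (E1 i im) (E2 j jm) ii jj (etrans (esym Di) Dj).
  apply: (traces_splice m10 ch1 rp1 f1 m20 ch2 rp2 f2 abc (ltnW im) (ltnW jm)) => //.
  by right; split.
- exfalso; apply: (Sin _ ii); rewrite -Di Dj.
  case: (bdj nj) => ->; first by rewrite subrr.
  by rewrite -natr1 addrAC subrr add0r.
- exfalso; apply: (Sjn _ jj); rewrite -Dj Di.
  case: (bdi ni) => ->; first by rewrite subrr.
  by rewrite -natr1 addrAC subrr add0r.
- have [I Im pI] : exists2 I, (I <= m1)%N & p1 b = I%:R.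
    by case: (bdi ni) => ->; [exists i => //; exact: ltnW|exists i.+1].
  have [J Jm pJ] : exists2 J, (J <= m2)%N & p2 b = J%:R.
    by case: (bdj nj) => ->; [exists j => //; exact: ltnW|exists j.+1].
  have [I0|I0] := posnP I; last first.
    apply: (traces_splice m10 ch1 rp1 f1 m20 ch2 rp2 f2 abc Im Jm).
      by rewrite pI pJ !subrr.
    by left.
  (* With [I = 0] the first parametrization vanishes on [[a, b]]. The path is constant there, and
     the second chain suffices, its parametrization frozen before [b]. *)
  have Dab t : a <= t <= b -> D t = D b.
    move=> ht; apply: (follows_eq m10 rp1 f1) => //.
    have := b1 t; have : p1 t <= p1 b by apply: h1; lra.
    by rewrite pI I0; lra.
  exists m2, e2, (fun x => p2 (Num.max x b)); split=> //.
  + split=> [x|x y xy|x]; last exact: b2.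
      apply: (@continuous_comp _ _ _ (fun x => Num.max x b) p2); last exact: c2.
      by apply: continuous_max => //; exact: cvg_cst.
    by apply: h2; rewrite ge_max !le_max xy lexx orbT.
  + move=> t k ht km; have [tb|bt] := leP t b => hk.
      rewrite Dab; last lra.
      exact: f2.
    by apply: f2 => //; lra.
Qed.

(** * Reparametrizations of the unit interval *)

Lemma continuous_max_min (R : realType) (a b : R) :
  continuous (fun x : R => Num.max a (Num.min x b)).
Proof.
move=> x; apply: (continuous_max (f := fun=> a) (g := fun x => Num.min x b)).
  exact: cvg_cst.
by apply: continuous_min => //; exact: cvg_cst.
Qed.

Lemma clamp_subproof (x : RR) : Num.max 0 (Num.min x 1) \in Iu_set.
Proof. by apply/mem_set; rewrite /Iu_set /= le_max lexx ge_max ler01 ge_min lexx orbT. Qed.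

(** A retraction of the line onto [[0, 1]]: precomposition with it extends a path on [Iu] by
    constants. *)
Definition clamp (x : RR) : Iu := exist (fun y => y \in Iu_set) _ (clamp_subproof x).

Definition ival (t : Iu) : RR := val t.

Lemma Iu_bounds (t : Iu) : 0 <= ival t <= 1.
Proof. by have := set_mem (valP t). Qed.

Lemma clamp_id (x : RR) : 0 <= x <= 1 -> ival (clamp x) = x.
Proof. by move=> /andP[x0 x1]; rewrite /ival /= min_l // max_r. Qed.

Lemma clampK (t : Iu) : clamp (ival t) = t.
Proof. by apply: val_inj; exact: clamp_id (Iu_bounds t). Qed.

Lemma continuous_Iu_val : continuous ival.
Proof. exact: initial_continuous. Qed.

Lemma continuous_clamp : continuous clamp.
Proof.
have cmm : continuous (fun x : RR => Num.max 0 (Num.min x 1)).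
  exact: continuous_max_min.
apply/continuousP => _ [B oB <-].
have -> : clamp @^-1` (set_val @^-1` B) = (fun x : RR => Num.max 0 (Num.min x 1)) @^-1` B.
  by apply/seteqP; split.
by have /continuousP := cmm; apply.
Qed.

Lemma le_clamp (x y : RR) : x <= y -> ival (clamp x) <= ival (clamp y).
Proof.
move=> xy; rewrite /ival /= ge_max le_max lexx /= le_max; apply/orP; right.
by rewrite le_min !ge_min xy lexx orbT.
Qed.

Lemma reparam_in_I1 (phi : Iu -> Iu) :
  in_I1 phi -> reparam 1 (fun x => ival (phi (clamp x)) : RR).
Proof.
move=> [cphi mphi]; split=> [x|x y xy|x]; last exact: Iu_bounds.
  apply: (@continuous_comp _ _ _ (phi \o clamp) ival); last exact: continuous_Iu_val.
  by apply: continuous_comp; [exact: continuous_clamp|exact: cphi].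
by apply: mphi; exact: le_clamp.
Qed.

Lemma in_I1_reparam (p : RR -> RR) : reparam 1 p -> in_I1 (fun t => clamp (p (ival t))).
Proof.
move=> [cp mp _]; split=> [t|s t st]; last by apply: le_clamp; exact: mp.
apply: (@continuous_comp _ _ _ (p \o ival) clamp); last exact: continuous_clamp.
by apply: continuous_comp; [exact: continuous_Iu_val|exact: cp].
Qed.

Lemma in_M11_id : in_M11 id.
Proof. by split=> [|u]; [split=> // x|exists u]. Qed.

Lemma ival_clamp0 : ival (clamp 0) = 0.
Proof. by rewrite clamp_id // lexx ler01. Qed.

Lemma ival_clamp1 : ival (clamp 1) = 1.
Proof. by rewrite clamp_id // lexx ler01. Qed.

Lemma in_M11_ends (phi : Iu -> Iu) :
  in_M11 phi -> phi (clamp 0) = clamp 0 /\ phi (clamp 1) = clamp 1.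
Proof.
move=> [[_ mphi] sphi].
have {}mphi s t : ival s <= ival t -> ival (phi s) <= ival (phi t) by exact: mphi.
have [t tE] := sphi (clamp 0); have [u uE] := sphi (clamp 1).
have [ht hu] := (Iu_bounds t, Iu_bounds u).
have [h0 h1] := (Iu_bounds (phi (clamp 0)), Iu_bounds (phi (clamp 1))).
have := mphi (clamp 0) t; have := mphi u (clamp 1).
rewrite tE uE ival_clamp0 ival_clamp1 => hm1 hm0.
split; apply: val_inj.
- change (ival (phi (clamp 0)) = ival (clamp 0)); rewrite ival_clamp0; lra.
- change (ival (phi (clamp 1)) = ival (clamp 1)); rewrite ival_clamp1; lra.
Qed.

(** * Normalized composition and realization of chains *)

Lemma normcomp_ival (T : Type) (g1 g2 d : Iu -> T) :
  normcomp g1 g2 d <-> forall t s : Iu,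
    (ival t <= 1 / 2 -> ival s = 2 * ival t -> d t = g1 s) /\
    (1 / 2 <= ival t -> ival s = 2 * ival t - 1 -> d t = g2 s).
Proof. by []. Qed.

Lemma normcompE1 (T : Type) (g1 g2 d : Iu -> T) (x : RR) :
  normcomp g1 g2 d -> 0 <= x <= 1 / 2 -> d (clamp x) = g1 (clamp (2 * x)).
Proof.
move=> /normcomp_ival nc hx; have xE : ival (clamp x) = x by apply: clamp_id; lra.
by have [-> //] := nc (clamp x) (clamp (2 * x)); rewrite ?xE ?clamp_id //; lra.
Qed.

Lemma normcompE2 (T : Type) (g1 g2 d : Iu -> T) (x : RR) :
  normcomp g1 g2 d -> 1 / 2 <= x <= 1 -> d (clamp x) = g2 (clamp (2 * x - 1)).
Proof.
move=> /normcomp_ival nc hx; have xE : ival (clamp x) = x by apply: clamp_id; lra.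
by have [_ -> //] := nc (clamp x) (clamp (2 * x - 1)); rewrite ?xE ?clamp_id //; lra.
Qed.

Lemma normcomp_ex (T : Type) (g1 g2 : Iu -> T) :
  g1 (clamp 1) = g2 (clamp 0) -> exists d, normcomp g1 g2 d.
Proof.
move=> g12; exists (fun t => if ival t <= 1 / 2 then g1 (clamp (2 * ival t))
                       else g2 (clamp (2 * ival t - 1))).
apply/normcomp_ival => t s; split=> ht hs.
  by rewrite ht -hs clampK.
case: ifPn => [ht'|_]; last by rewrite -hs clampK.
(* At the midpoint both formulas apply, and the matching endpoints make them agree. *)
have tE : ival t = 1 / 2 by apply/eqP; rewrite eq_le ht ht'.
rewrite -[s]clampK hs tE (_ : 2 * (1 / 2) = 1); last by field.
by rewrite subrr.
Qed.

Lemma continuous_affine (R : realType) (a b : R) : continuous (fun x : R => a * x + b).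
Proof.
move=> x; apply: cvgD; last exact: cvg_cst.
by apply: cvgM; [exact: cvg_cst|exact: cvg_id].
Qed.

Lemma nondecreasing_affine (R : realType) (a b : R) :
  0 <= a -> {homo (fun x : R => a * x + b) : x y / x <= y}.
Proof. by move=> a0 x y xy; rewrite lerD2r ler_wpM2l. Qed.

Lemma traces_affine (R : realType) (T : Type) (E : set (R -> T)) (D D' : R -> T)
    (a b a' b' u v : R) :
  0 <= u -> (forall t, a' <= t <= b' -> a <= u * t + v <= b) ->
  (forall t, a' <= t <= b' -> D' t = D (u * t + v)) ->
  traces E D a b -> traces E D' a' b'.
Proof.
move=> u0 huv eqD trD; apply: (@traces_eq _ _ _ (D \o (fun t => u * t + v))).
  by move=> t ht; rewrite eqD.
exact: traces_comp (@continuous_affine _ u v) (nondecreasing_affine _ u0) huv trD.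
Qed.

Lemma traces_normcomp (T : Type) (S : set T) (E : set (RR -> T)) (g1 g2 d : Iu -> T) :
  arc_family S E -> normcomp g1 g2 d ->
  traces E (g1 \o clamp) 0 1 -> traces E (g2 \o clamp) 0 1 ->
  traces E (d \o clamp) 0 1.
Proof.
move=> afE nc tr1 tr2; apply: (@traces_glue _ _ S _ _ _ (1 / 2)) => //; first lra.
- apply: (@traces_affine RR _ _ _ _ 0 1 _ _ 2 0 _ _ _ tr1) => //; first by move=> t; lra.
  by move=> t ht /=; rewrite addr0 (normcompE1 nc).
- apply: (@traces_affine RR _ _ _ _ 0 1 _ _ 2 (-1) _ _ _ tr2) => //; first by move=> t; lra.
  by move=> t ht /=; rewrite (normcompE2 nc).
Qed.

Lemma reparam_comp (R : realType) (m n : R) (p q : R -> R) :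
  reparam n q -> reparam m p -> reparam n (q \o p).
Proof.
move=> [cq mq bq] [cp mp _]; split=> [x|x y xy|x]; last exact: bq.
  by apply: continuous_comp; [exact: cp|exact: cq].
exact/mq/mp.
Qed.

Lemma reparam_shift (R : realType) (m v : R) (p : R -> R) :
  reparam m p -> reparam m (fun x => p (x + v)).
Proof.
move=> [cp mp pm]; split=> [x|x y xy|x]; last exact: pm.
  apply: (@continuous_comp _ _ _ (fun x => x + v) p); last exact: cp.
  by apply: cvgD; [exact: cvg_id|exact: cvg_cst].
by apply: mp; rewrite lerD2r.
Qed.

Lemma reparam_join_half (R : realType) (b : R) (p q : R -> R) :
  reparam 1 p -> reparam 1 q -> q b = 0 ->
  reparam 1 (fun x => (p (Num.min x b) + (q (Num.max x b) - q b)) / 2).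
Proof.
move=> [cp mp bp] [cq mq bq] q0; split=> [x|x y xy|x].
- by apply: cvgM; [exact: continuous_join|exact: cvg_cst].
- by rewrite ler_pM2r ?invr_gt0 ?ltr0n //; exact: nondecreasing_join.
- have := bp (Num.min x b); have := bq (Num.max x b).
  by rewrite q0; lra.
Qed.

(* [kappa] inverts a parametrization of [gam] by [[0, m]]; only this direction
   is needed, so no inverse homeomorphism has to be constructed. *)
Lemma chain_realization (X : mds) (E : set (RR -> X)) m (e : nat -> RR -> X) :
  is_mds X -> (forall u, E u -> mpaths X (u \o ival)) ->
  (0 < m)%N -> chain E m e ->
  exists gam kappa, [/\ mpaths X gam, reparam 1 kappa, kappa m%:R = 1 &
    forall i x, (i < m)%N -> 0 <= x - i%:R <= 1 ->
      gam (clamp (kappa x)) = e i (x - i%:R)].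
Proof.
move=> [_ [_ ncX]] EX; case: m => // m _; elim: m => [|m IH] [Ee ech].
  exists (e 0%N \o ival), (fun x => ival (clamp x)); split.
  - exact/EX/Ee.
  - exact: (reparam_in_I1 in_M11_id.1).
  - by rewrite clamp_id // lexx ler01.
  - by move=> [|//] x _; rewrite subr0 => hx; rewrite clampK /= clamp_id.
have [gam [kap [Xgam rkap kapm gamE]]] : exists gam kappa,
    [/\ mpaths X gam, reparam 1 kappa, kappa m.+1%:R = 1 &
    forall i x, (i < m.+1)%N -> 0 <= x - i%:R <= 1 ->
      gam (clamp (kappa x)) = e i (x - i%:R)].
  by apply: IH; split=> i im; [apply: Ee|apply: ech]; lia.
have [ck mk bk] := rkap.
have junction : gam (clamp 1) = (e m.+1 \o ival) (clamp 0).
  rewrite /= ival_clamp0 -ech // -[in LHS]kapm.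
  have e1 : 1 = m.+1%:R - m%:R :> RR by rewrite -natr1; ring.
  by rewrite (gamE m) // -e1 // lexx ler01.
have [d nc] := normcomp_ex junction.
pose q x : RR := ival (clamp (x - m.+1%:R)).
have q0 : q m.+1%:R = 0 by rewrite /q subrr clamp_id // lexx ler01.
(* The old parametrization is squeezed into [[0, 1/2]] and the last unit interval is mapped affinely
   onto [[1/2, 1]], matching the two halves of [d]. *)
pose kap' x : RR := (kap (Num.min x m.+1%:R) + (q (Num.max x m.+1%:R) - q m.+1%:R)) / 2.
have rq : reparam 1 q := reparam_shift (- m.+1%:R) (reparam_in_I1 in_M11_id.1).
exists d, kap'; split.
- by apply: ncX nc; [|apply: EX; exact: Ee].
- exact: reparam_join_half.
- have mm : m.+1%:R <= m.+2%:R :> RR by rewrite ler_nat.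
  rewrite /kap' min_r // max_l // q0 kapm /q -[m.+2%:R]natr1 clamp_id; lra.
- have lo x : 0 <= x <= m.+1%:R -> d (clamp (kap' x)) = gam (clamp (kap x)).
    move=> /andP[x0 xm]; rewrite /kap' min_l // max_r // q0 subrr addr0.
    rewrite (normcompE1 nc); first by congr (gam (clamp _)); lra.
    by have := bk x; lra.
  have i0 (i : nat) : 0 <= i%:R :> RR by rewrite ler0n.
  move=> i x; rewrite ltnS leq_eqVlt => /orP[/eqP -> hx|im hx]; last first.
    have := i0 i; have : i.+1%:R <= m.+1%:R :> RR by rewrite ler_nat.
    by rewrite -(natr1 i) => h1 h2; rewrite lo; [exact: gamE|lra].
  have := i0 m.+1; move: hx.
  have [xm|xm] := leP x m.+1%:R => hx m0.
    (* The last arc starts at the junction, where the formula for the earlier arcs still applies. *)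
    have xE : x = m.+1%:R by lra.
    rewrite xE lo; last lra.
    by rewrite kapm junction subrr /= ival_clamp0.
  have xm' := ltW xm.
  rewrite /kap' min_r // max_l // q0 kapm subr0 /q clamp_id //.
  rewrite (normcompE2 nc) /=; last lra.
  by congr (e _ _); rewrite [ival _]clamp_id; lra.
Qed.

(** * Colimits on underlying sets *)

Definition indiscrete (T : Type) : Type := T.
HB.instance Definition _ (T : Type) := gen_eqMixin (indiscrete T).
HB.instance Definition _ (T : Type) := gen_choiceMixin (indiscrete T).

Definition indiscrete_open (T : Type) (U : set (indiscrete T)) : Prop :=
  forall x y, U x -> U y.

Lemma indiscrete_openT (T : Type) : indiscrete_open (@setT (indiscrete T)).
Proof. by []. Qed.

Lemma indiscrete_openI (T : Type) : setI_closed (@indiscrete_open T).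
Proof. by move=> A B oA oB x y [Ax Bx]; split; [exact: oA Ax|exact: oB Bx]. Qed.

Lemma indiscrete_open_bigU (T I : Type) (F : I -> set (indiscrete T)) :
  (forall i, indiscrete_open (F i)) -> indiscrete_open (\bigcup_i F i).
Proof. by move=> oF x y [i _ Fx]; exists i => //; exact: oF Fx. Qed.

HB.instance Definition _ (T : Type) :=
  isOpenTopological.Build (indiscrete T) (@indiscrete_openT T) (@indiscrete_openI T)
    (@indiscrete_open_bigU T).

(* Every map into such an object is a morphism, so the universal properties of
   multipointed d-spaces restrict to those of the underlying sets. *)
Definition indiscrete_mds (T : Type) : mds := @MDS (indiscrete T) setT setT.

Lemma continuous_indiscrete (A : topologicalType) (T : Type) (f : A -> indiscrete T) :
  continuous f.
Proof.
apply/continuousP => U oU; have [->|/set0P[x Ux]] := eqVneq U set0.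
  by rewrite preimage_set0; exact: open0.
suff -> : U = setT by rewrite preimage_setT; exact: openT.
by apply/seteqP; split=> // y _; exact: (oU x).
Qed.

Lemma is_mds_indiscrete (T : Type) : is_mds (indiscrete_mds T).
Proof. by split=> // g _; split=> //; exact: continuous_indiscrete. Qed.

Lemma mor_indiscrete (X : mds) (T : Type) (f : X -> indiscrete_mds T) : mor f.
Proof. by split=> //; exact: continuous_indiscrete. Qed.

(** The universal property is tested on the indiscrete object on [C + B]: [u] sends the image of [i]
    to [C] through [g] and the rest of [B] to itself. The induced map out of [D] separates the
    points in question. *)
Lemma pushout_along_injection (A B C D : mds) (i : A -> B) (g : A -> C) (h : B -> D)
    (k : C -> D) :
  is_pushout i g h k -> injective i ->
  [/\ injective k,
      forall b y, ~ (exists a, i a = b) -> h b <> k y &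
      forall b b', ~ (exists a, i a = b) -> ~ (exists a, i a = b') ->
        h b = h b' -> b = b'].
Proof.
move=> [_ [_ [_ [_ [_ univ]]]]] i_inj.
pose u (b : B) : indiscrete_mds (C + B) :=
  if pselect (exists a, i a = b) is left P then inl (g (projT1 (cid P))) else inr b.
have uE b : ~ (exists a, i a = b) -> u b = inr b by rewrite /u; case: pselect.
have [|w [_ [wh [wk _]]]] := univ _ (is_mds_indiscrete _) u
    (inl : C -> indiscrete_mds (C + B)) (mor_indiscrete _) (mor_indiscrete _).
  apply/funext => a /=; rewrite /u; case: pselect => [P|[]]; last by exists a.
  by congr (inl (g _)); apply: i_inj; exact: (projT2 (cid P)).
have {}wh b : w (h b) = u b by rewrite -wh.
have {}wk y : w (k y) = inl y by rewrite -[RHS]/((inl : C -> indiscrete_mds (C + B)) y) -wk.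
split=> [y y' eqk|b y nb eqhk|b b' nb nb' eqh].
- by have := wk y; rewrite eqk wk => -[].
- by have := wk y; rewrite -eqhk wh uE.
- by have := wh b; rewrite eqh wh !uE // => -[].
Qed.

Lemma wle_refl (W : wo) (a : W) : wle a a.
Proof. by right. Qed.

Lemma wle_trans (W : wo) (a b c : W) : wle a b -> wle b c -> wle a c.
Proof. by move=> [ab|->] // [bc|<-]; left => //; exact: wlt_trans ab bc. Qed.

Lemma wle_total (W : wo) (a b : W) : wle a b \/ wle b a.
Proof.
by have [|[]] := wlt_total a b => ab; [left; left|left; right|right; left].
Qed.

Lemma wle_lt (W : wo) (a b : W) : wle a b \/ wlt b a.
Proof.
by have [|[]] := wlt_total a b => ab; [left; left|left; right|right].
Qed.

Lemma wo_cases (W : wo) (n : W) :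
  (forall m, ~ wlt m n) \/ (exists p, is_succ_idx p n) \/ is_limit_idx n.
Proof.
have [min|/existsNP[m /contrapT mn]] := pselect (forall m, ~ wlt m n); first by left.
have [?|nsucc] := pselect (exists p, is_succ_idx p n); first by right; left.
right; right; split=> [|q qn]; first by exists m.
apply: contrapT => nq; apply: nsucc; exists q; split=> // p pq.
by apply: nq; exists p.
Qed.

Lemma is_succ_wle (W : wo) (n n' m : W) : is_succ_idx n n' -> wlt m n' -> wle m n.
Proof. by move=> [_ H] mn'; have [//|nm] := wle_lt m n; case: (H m). Qed.

Lemma is_succ_uniq (W : wo) (n p q : W) : is_succ_idx n p -> is_succ_idx n q -> p = q.
Proof.
move=> [np hp] [nq hq].
by have [|[//|]] := wlt_total p q => H; [case: (hq p)|case: (hp q)].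
Qed.

(** The germ map [d] factors through [Z], so points identified in [Z] have equal germs. They then
    agree at some stage [r], and injectivity of [f n r] makes them equal. *)
Lemma colimit_injective (W : wo) (P : W -> Prop) (Xs : W -> mds)
    (f : forall m n : W, Xs m -> Xs n) (Z : mds) (c : forall n : W, Xs n -> Z) :
  is_colim P f c ->
  (forall m n p, wle m n -> wle n p -> f n p \o f m n = f m p) ->
  (forall m n, P m -> P n -> wle m n -> injective (f m n)) ->
  forall n, P n -> injective (c n).
Proof.
move=> [_ [_ univ]] fcomp finj.
have fE m n p x : wle m n -> wle n p -> f n p (f m n x) = f m p x.
  by move=> mn np; rewrite -(fcomp m n p).
(* The colimit of sets, as the set of germs of the system. *)
pose d n (x : Xs n) : indiscrete_mds (set {p & Xs p}) :=
  [set q | exists r, [/\ P r, wle n r, wle (projT1 q) r &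
                         f n r x = f (projT1 q) r (projT2 q)]].
have [|w [_ [wE _]]] := univ _ (is_mds_indiscrete _) d (fun n _ => mor_indiscrete (@d n)).
  move=> m n Pm Pn mn; apply/funext => x /=; apply/seteqP; split=> -[q y] /= [r [Pr h1 h2 h3]].
    exists r; split=> //; first exact: wle_trans mn h1.
    by rewrite -h3 fE.
  (* A witness stage below [n] is replaced by [n] itself. *)
  have [nr|rn] := wle_total n r; first by exists r; split=> //; rewrite fE.
  exists n; split=> //; [exact: wle_refl|exact: wle_trans h2 rn|].
  rewrite fE //; last exact: wle_refl.
  by rewrite -(fE m r n) // h3 fE.
move=> n Pn x y eqc.
have eqd : d n x = d n y by rewrite -(wE n Pn) /= eqc.
have : d n y (existT _ n y) by exists n; split=> //; exact: wle_refl.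
rewrite -eqd => -[r [Pr nr _ /= h]].
by apply: (finj n r).
Qed.

Lemma glob_map_injective (Z Z' : topologicalType) (u : Z -> Z') :
  injective u -> injective (glob_map u).
Proof. by move=> ui [||z t] [||z' t'] //= [/ui -> ->]. Qed.

Lemma sph_incl_injective n : injective (@sph_incl n).
Proof. by move=> x y /(congr1 val) /= h; exact: val_inj. Qed.

Lemma gdelta_mid (Z : Type) (z : Z) (t : RR) :
  0 < t < 1 -> exists2 s : mid_set, val s = t & gdelta z (clamp t) = Gm z s.
Proof.
move=> ht; rewrite /gdelta; have tE : val (clamp t) = t by apply: clamp_id; lra.
case: insubP => [s _ sE|]; first by exists s => //; rewrite sE.
by rewrite tE => /negP[]; apply/mem_set.
Qed.

Lemma gdelta0 (Z : Type) (z : Z) : gdelta z (clamp 0) = G0.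
Proof.
rewrite /gdelta; have -> : val (clamp 0) = 0 := ival_clamp0.
case: insubP => [s /set_mem h _|_]; last by rewrite eqxx.
by move: h; rewrite /mid_set /= ltxx.
Qed.

Lemma gdelta1 (Z : Type) (z : Z) : gdelta z (clamp 1) = G1.
Proof.
rewrite /gdelta; have -> : val (clamp 1) = 1 := ival_clamp1.
case: insubP => [s /set_mem h _|_]; last by rewrite oner_eq0.
by move: h; rewrite /mid_set /= ltxx andbF.
Qed.

Lemma glob_map_gdelta (Z Z' : topologicalType) (u : Z -> Z') z t :
  glob_map u (gdelta z t) = gdelta (u z) t.
Proof. by rewrite /gdelta; case: insubP => // _; case: ifP. Qed.

(** * Open cells of a cellular multipointed d-space *)

Section Cellular.

Variables (X : mds) (W : wo) (Xs : W -> mds).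
Variables (f : forall m n : W, Xs m -> Xs n) (c : forall n : W, Xs n -> X).
Arguments f : clear implicits.
Arguments c : clear implicits.

Hypothesis X_mds : is_mds X.
Hypothesis f_comp : forall m n p, wle m n -> wle n p -> f n p \o f m n = f m p.
Hypothesis f_id : forall n, f n n = id.
Hypothesis c_colim : is_colim (fun _ => True) f c.
Hypothesis f_colim :
  forall n, is_limit_idx n -> is_colim (fun m => wlt m n) f (fun m => f m n).
Hypothesis bottom : forall n, (forall m, ~ wlt m n) ->
  mstates (Xs n) = setT /\ mpaths (Xs n) = set0.
Hypothesis attach : forall n n', is_succ_idx n n' ->
  exists (k : nat) (g : Glob (Sphere k) -> Xs n) (h : Glob (Disk k) -> Xs n'),
    is_pushout (@glob_incl k) g h (f n n').

(** Since [attach] only asserts existence, the cell of each successor step is fixed here by choice,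
    together with its two maps below. *)
Definition cell_dim n n' (H : is_succ_idx n n') : nat := projT1 (cid (attach H)).

Definition attaching_map n n' (H : is_succ_idx n n') :
    Glob (Sphere (cell_dim H)) -> Xs n := projT1 (cid (projT2 (cid (attach H)))).

Definition characteristic_map n n' (H : is_succ_idx n n') :
    Glob (Disk (cell_dim H)) -> Xs n' :=
  projT1 (cid (projT2 (cid (projT2 (cid (attach H)))))).

Arguments attaching_map {n n'} H _.
Arguments characteristic_map {n n'} H _.

Lemma cell_pushout n n' (H : is_succ_idx n n') :
  is_pushout (@glob_incl _) (attaching_map H) (characteristic_map H) (f n n').
Proof. exact: (projT2 (cid (projT2 (cid (projT2 (cid (attach H))))))). Qed.

Lemma glob_incl_injective k : injective (@glob_incl k).
Proof. exact/glob_map_injective/sph_incl_injective. Qed.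

(** Transfinite induction on the target: a successor step is a pushout of an injection, a limit step
    a colimit of injections. *)
Lemma f_injective n m : wle m n -> injective (f m n).
Proof.
elim/(well_founded_ind (@wlt_wf W)): n m => n IH m.
move=> [mn|->]; last by rewrite f_id.
have [nmin|[[p pn]|lim]] := wo_cases n; first by case: (nmin m).
  have mp := is_succ_wle pn mn; have pn' : wle p n by left; exact: pn.1.
  rewrite -(f_comp mp pn'); apply: inj_comp; last exact: IH pn.1 _ mp.
  by have [] := pushout_along_injection (cell_pushout pn) (@glob_incl_injective _).
apply: (colimit_injective (f_colim lim)) => // q p _ pn qp.
exact: IH.
Qed.

Lemma c_injective n : injective (c n).
Proof. by apply: (colimit_injective c_colim) => // m p _ _; exact: f_injective. Qed.

Lemma cE m n x : wle m n -> c n (f m n x) = c m x.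
Proof. by move=> mn; have [_ [cc _]] := c_colim; rewrite -(cc m n). Qed.

Lemma fE m n p x : wle m n -> wle n p -> f n p (f m n x) = f m p x.
Proof. by move=> mn np; rewrite -(f_comp mn np). Qed.

Lemma mor_c n : mor (c n).
Proof. by have [mc _] := c_colim; exact: mc. Qed.

(** The set $X^0$ inside [X]; the least element of [W] is not named, hence the minimal index [n]. *)
Definition bottom_states : set X :=
  [set x | exists n y, (forall m, ~ wlt m n) /\ x = c n y].

Definition cell_arc n n' (H : is_succ_idx n n') (z : Disk (cell_dim H)) (x : RR) : X :=
  c n' (characteristic_map H (gdelta z (clamp x))).

(** Parameters on the sphere are excluded, since their arcs come from the earlier stage. The
    endpoint conditions are built in because they are established only in the induction, by
    [mor_characteristic_traced]. *)
Definition open_cell_arcs : set (RR -> X) :=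
  [set e | exists (n n' : W) (H : is_succ_idx n n') (z : Disk (cell_dim H)),
    [/\ ~ (exists y, sph_incl y = z), e = cell_arc z,
        bottom_states (e 0) & bottom_states (e 1)]].

Lemma Gm_notin_glob_incl k (z : Disk k) s :
  ~ (exists y, sph_incl y = z) -> ~ (exists a, @glob_incl k a = Gm z s).
Proof. by move=> nz [[||y t] //= [yz _]]; apply: nz; exists y. Qed.

(** An interior point of a cell is new at stage [n'], and injectivity of [c] keeps it apart from all
    earlier points. *)
Lemma open_cell_notin n n' (H : is_succ_idx n n') (z : Disk (cell_dim H)) t m y :
  ~ (exists y, sph_incl y = z) -> 0 < t < 1 -> wle m n -> cell_arc z t <> c m y.
Proof.
move=> nz ht mn; have [s _ sE] := gdelta_mid z ht.
have nn' : wle n n' by left; exact: H.1.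
rewrite /cell_arc sE -(cE _ (wle_trans mn nn')) => /c_injective.
rewrite -(fE _ mn nn').
have [_ + _] := pushout_along_injection (cell_pushout H) (@glob_incl_injective _).
by apply; exact: Gm_notin_glob_incl.
Qed.

(** For cells of different stages, the points of the later one are new. Within one cell, the pushout
    is injective off the image of the smaller globe. *)
Lemma arc_family_open_cells : arc_family bottom_states open_cell_arcs.
Proof.
split=> [e [n [n' [H [z [nz -> S0 S1]]]]]|].
  split=> // t ht [m [y [mmin]]]; apply: open_cell_notin => //.
  by have [//|nm] := wle_lt m n; case: (mmin n).
move=> _ _ t t' [n [n' [H [z [nz -> _ _]]]]] [p [p' [H' [z' [nz' -> _ _]]]]] ht ht' eqe.
have [np|[np|pn]] := wlt_total n p.
- have np' : wle n' p.
    by have [//|pn'] := wle_lt n' p; case: (H.2 p).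
  by exfalso; apply: (open_cell_notin nz' ht' np' (esym eqe)).
- subst p; have ? := is_succ_uniq H H'; subst p'.
  (* The cell was chosen from the proof of succession, so the two proofs are identified before [z]
     and [z'] are compared. *)
  have ? : H = H' by exact: Prop_irrelevance.
  subst H'; move: eqe; rewrite /cell_arc.
  have [s sE ->] := gdelta_mid z ht; have [s' sE' ->] := gdelta_mid z' ht'.
  move=> /c_injective.
  have [_ _ inj] := pushout_along_injection (cell_pushout H) (@glob_incl_injective _).
  move=> /(inj _ _ (@Gm_notin_glob_incl _ _ s nz) (@Gm_notin_glob_incl _ _ s' nz')) [-> ss'].
  by rewrite -sE -sE' ss'.
- have pn' : wle p' n.
    by have [//|np'] := wle_lt p' n; case: (H'.2 n).
  by exfalso; apply: (open_cell_notin nz ht pn' eqe).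
Qed.

Lemma mpaths_cell_arc n n' (H : is_succ_idx n n') (z : Disk (cell_dim H)) phi :
  in_M11 phi -> mpaths X (fun t => cell_arc z (ival (phi t))).
Proof.
move=> Mphi; have [_ [_ [[_ [_ mh]] _]]] := cell_pushout H.
have [_ [_ mc]] := mor_c n'.
have -> : (fun t => cell_arc z (ival (phi t))) =
    c n' \o (characteristic_map H \o (gdelta z \o phi)).
  by apply/funext => t; rewrite /cell_arc clampK.
by apply: mc; apply: mh; exists z, phi.
Qed.

(** * Execution paths follow chains of open cells *)

(* The same space with only those execution paths that follow a chain of open
   cells; the universal properties force it to be all of [X]. *)
Definition traced_mds : mds :=
  @MDS (mcar X) bottom_states
    [set g | [/\ mpaths X g, traces open_cell_arcs (g \o clamp) 0 1,
                 bottom_states (g (clamp 0)) & bottom_states (g (clamp 1))]].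

Lemma is_mds_traced : is_mds traced_mds.
Proof.
have [Xc [XM Xn]] := X_mds; split; last split.
- move=> g [Xg _ S0 S1]; split=> [|t]; first exact: (Xc g Xg).1.
  by move=> [] tE; rewrite -[t]clampK /ival tE.
- move=> g phi [Xg tr S0 S1] Mphi; have [phi0 phi1] := in_M11_ends Mphi.
  split; rewrite /= ?phi0 ?phi1 //; first exact: XM.
  have [cp mp bp] := reparam_in_I1 Mphi.1.
  apply: traces_eq (traces_comp cp mp _ tr) => [t _ /=|t _]; last exact: bp.
  by rewrite clampK.
- move=> g1 g2 d [X1 t1 S10 S11] [X2 t2 S20 S21] nc; split.
  + exact: Xn nc.
  + exact: traces_normcomp arc_family_open_cells nc t1 t2.
  + by rewrite (normcompE1 nc) ?mulr0 //; lra.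
  + rewrite (normcompE2 nc); last lra.
    by rewrite (_ : 2 * 1 - 1 = 1) //; lra.
Qed.

(** The identity is a morphism from [traced_mds] to [X]: bottom states are states because every
    point of the initial stage is one. *)
Lemma mor_traced (Y : mds) (u : Y -> X) : mor (u : Y -> traced_mds) -> mor u.
Proof.
move=> [cu [su mu]]; split=> //; split=> [y /su[n [x [nmin ->]]]|g /mu[]//].
by have [_ [sc _]] := mor_c n; apply: sc; rewrite (bottom nmin).1.
Qed.

(** For [z] on the sphere the path already comes from [Xs n]; otherwise it runs along a single open
    arc. Its endpoints come from [G0] and [G1], which lie in the smaller globe even when the sphere
    is empty. *)
Lemma mor_characteristic_traced n n' (H : is_succ_idx n n') :
  mor (c n : Xs n -> traced_mds) ->
  mor (c n' \o characteristic_map H : Glob (Disk (cell_dim H)) -> traced_mds).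
Proof.
move=> [_ [sc pc]].
have [_ [[_ [sg pg]] [[ch _] [_ [sq _]]]]] := cell_pushout H.
have nn' : wle n n' by left; exact: H.1.
have cq a : c n' (characteristic_map H (glob_incl a)) = c n (attaching_map H a).
  by rewrite -(cE _ nn'); congr (c n' _); rewrite -[LHS]/((_ \o _) a) sq.
have S0 : bottom_states (c n' (characteristic_map H G0)).
  by rewrite -[G0]/(@glob_incl (cell_dim H) G0) cq; apply: sc; apply: sg; left.
have S1 : bottom_states (c n' (characteristic_map H G1)).
  by rewrite -[G1]/(@glob_incl (cell_dim H) G1) cq; apply: sc; apply: sg; right.
split; last split.
- move=> x; apply: continuous_comp; first exact: ch.
  by have [cc _] := mor_c n'; exact: cc.
- by move=> x [] -> /=.
- move=> _ [z [phi [Mphi ->]]]; have [phi0 phi1] := in_M11_ends Mphi.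
  have [[y yz]|nz] := pselect (exists y, sph_incl y = z).
    have -> : (c n' \o characteristic_map H) \o (gdelta z \o phi) =
        c n \o (attaching_map H \o (gdelta y \o phi)).
      by apply/funext => t /=; rewrite -cq /glob_incl glob_map_gdelta yz.
    by apply: pc; apply: pg; exists y, phi.
  have arcE : (c n' \o characteristic_map H) \o (gdelta z \o phi) =
      fun t => cell_arc z (ival (phi t)).
    by apply/funext => t; rewrite /cell_arc clampK.
  split; rewrite ?arcE; first exact: mpaths_cell_arc.
  + apply: (@traces_arc RR _ _ (cell_arc z) (fun x => ival (phi (clamp x)))).
      exists n, n', H, z; split=> //; first by rewrite /cell_arc gdelta0.
      by rewrite /cell_arc gdelta1.
    exact: reparam_in_I1 Mphi.1.
  + by rewrite phi0 ival_clamp0 /cell_arc gdelta0.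
  + by rewrite phi1 ival_clamp1 /cell_arc gdelta1.
Qed.

(** At each stage the universal property gives a morphism [w] to [traced_mds]; uniqueness of the
    induced map to [X] identifies it with [c n]. *)
Lemma mor_c_traced n : mor (c n : Xs n -> traced_mds).
Proof.
elim/(well_founded_ind (@wlt_wf W)): n => n IH.
have [_ [cc _]] := c_colim.
have [nmin|[[p pn]|lim]] := wo_cases n.
- have [_ p0] := bottom nmin; have [mcc _] := mor_c n; split=> //; split.
    by move=> y _; exists n, y.
  by move=> g; rewrite p0.
- have IHp := IH p pn.1; have pn' : wle p n by left; exact: pn.1.
  have [_ [_ [_ [_ [sq univ]]]]] := cell_pushout pn.
  have mch := mor_characteristic_traced pn IHp.
  have eqcc : (c n \o characteristic_map pn) \o @glob_incl _ = c p \o attaching_map pn.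
    by rewrite -compA sq compA cc.
  have [w [mw [wh [wf _]]]] := univ _ is_mds_traced _ _ mch IHp eqcc.
  (* Here the target is [X], and only the uniqueness clause is kept. *)
  have [w0 [_ [_ [_ w0u]]]] := univ _ X_mds _ _ (mor_traced mch) (mor_c p) eqcc.
  suff -> : c n = w :> (Xs n -> X) by [].
  rewrite (w0u w (mor_traced mw) wh wf).
  by apply: w0u => //; [exact: mor_c|exact: cc].
- have [_ [_ univ]] := f_colim lim.
  have comp m p : wlt m n -> wlt p n -> wle m p -> c p \o f m p = c m by move=> _ _; exact: cc.
  have [w [mw [wf _]]] := univ _ is_mds_traced c IH comp.
  have [w0 [_ [_ w0u]]] := univ _ X_mds c (fun m _ => mor_c m) comp.
  suff -> : c n = w :> (Xs n -> X) by [].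
  rewrite (w0u w (mor_traced mw) wf).
  by apply: w0u => [|m mn]; [exact: mor_c|apply: cc => //; left].
Qed.

Lemma mpaths_traces g : mpaths X g -> traces open_cell_arcs (g \o clamp) 0 1.
Proof.
have [_ [cc univ]] := c_colim.
have [w [mw [wc _]]] := univ _ is_mds_traced c (fun m _ => mor_c_traced m) cc.
have [w0 [_ [_ w0u]]] := univ _ X_mds c (fun m _ => mor_c m) cc.
(* Both [w] and the identity are morphisms to [X] compatible with the cocone. *)
have wid : (w : X -> X) = id.
  rewrite (w0u w (mor_traced mw) wc); apply/esym/w0u => //.
  by split=> // x; exact: cvg_id.
by move=> Xg; have [_ [_ /(_ _ Xg)]] := mw; rewrite wid => -[].
Qed.

(** * Directed paths and their factorization *)

Lemma mpaths_open_cell_arc e : open_cell_arcs e -> mpaths X (e \o ival).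
Proof.
move=> [n [n' [H [z [_ -> _ _]]]]].
exact: (@mpaths_cell_arc _ _ H z id in_M11_id).
Qed.

(** The chain is realized by one execution path [g]; the parametrization [p] of the chain, followed
    by [kap], becomes the required map of the unit interval. *)
Lemma traces_factor (d : Iu -> X) :
  traces open_cell_arcs (d \o clamp) 0 1 ->
  exists g phi, [/\ mpaths X g, in_I1 phi & d = g \o phi].
Proof.
move=> [m [e [p [m0 ch rp fol]]]].
have [g [kap [Xg rk _ gE]]] := chain_realization X_mds mpaths_open_cell_arc m0 ch.
have [cp mp bp] := rp; have [ck mk bk] := rk.
exists g, (fun t => clamp (kap (p (ival t)))); split=> //.
  apply: (@in_I1_reparam (kap \o p)); exact: reparam_comp rk rp.
apply/funext => t /=; have [i im hi] := ex_unit_interval m0 (bp (ival t)).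
rewrite (gE i) // -(fol (ival t) i) //=; first by rewrite clampK.
exact: Iu_bounds.
Qed.

(** Each piece is a reparametrized execution path, hence follows a chain; the pieces are glued one
    by one at the break points [L i]. *)
Lemma moore_traces (d : Iu -> X) k (l : nat -> RR) (g : nat -> Iu -> X)
    (phi : nat -> Iu -> Iu) :
  (forall i, (i < k)%N -> 0 < l i) -> \sum_(i < k) l i = 1 ->
  (forall i, (i < k)%N -> mpaths X (g i) /\ in_I1 (phi i)) ->
  (forall i, (i < k)%N -> forall t s : Iu,
     \sum_(j < i) l j <= ival t <= \sum_(j < i) l j + l i ->
     ival s = (ival t - \sum_(j < i) l j) / l i -> d t = g i (phi i s)) ->
  (0 < k)%N -> traces open_cell_arcs (d \o clamp) 0 1.
Proof.
move=> l0 l1 hg hd k0.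
pose L i := \sum_(j < i) l j.
have LS i : L i.+1 = L i + l i by rewrite /L big_ord_recr.
have Lge0 i : (i <= k)%N -> 0 <= L i.
  by move=> ik; apply: sumr_ge0 => j _; apply/ltW/l0; exact: leq_trans (ltn_ord j) ik.
have Lmono i r : (i + r <= k)%N -> L i <= L (i + r)%N.
  elim: r => [|r IHr]; rewrite ?addn0 // addnS => irk.
  by apply: (le_trans (IHr (ltnW irk))); rewrite [leRHS]LS lerDl ltW // l0.
have Lle1 i : (i <= k)%N -> L i <= 1.
  by move=> ik; rewrite -l1; have := Lmono i (k - i)%N; rewrite subnKC //; exact.
suff H i : (i < k)%N -> traces open_cell_arcs (d \o clamp) 0 (L i.+1).
  by have := H k.-1; rewrite prednK // => /(_ (leqnn _)); rewrite /L l1.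
have piece j : (j < k)%N -> traces open_cell_arcs (d \o clamp) (L j) (L j.+1).
  move=> jk; have [Xg Iphi] := hg j jk; have lj := l0 j jk.
  have [cp mp bp] := reparam_in_I1 Iphi.
  have trg : traces open_cell_arcs
      ((g j \o clamp) \o (fun x => ival (phi j (clamp x)))) 0 1.
    by apply: traces_comp cp mp _ (mpaths_traces Xg) => t _; exact: bp.
  have L0 := Lge0 j (ltnW jk); have L1 := Lle1 _ jk; rewrite LS in L1 *.
  (* The affine map is [t] sent to [(t - L j) / l j], which stretches the [j]-th piece to the unit
     interval. *)
  apply: (@traces_affine RR _ _ _ _ 0 1 _ _ (l j)^-1 (- (L j / l j)) _ _ _ trg).
  - by rewrite invr_ge0 ltW.
  - move=> t ht; rewrite mulrC -mulrBl.
    by rewrite ler_pdivlMr // ler_pdivrMr // mul0r mul1r; lra.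
  - move=> t ht /=; rewrite clampK mulrC -mulrBl.
    have hq : 0 <= (t - L j) / l j <= 1.
      by rewrite ler_pdivlMr // ler_pdivrMr // mul0r mul1r; lra.
    have tE : ival (clamp t) = t by apply: clamp_id; lra.
    by apply: (hd j jk); rewrite ?tE // clamp_id.
elim: i => [|i IH] ik; first by have := piece 0%N ik; rewrite {1}/L big_ord0.
apply: (traces_glue arc_family_open_cells _ (IH (ltnW ik)) (piece _ ik)).
by rewrite Lge0 ?(ltnW ik) //= [leRHS]LS lerDl ltW // l0.
Qed.

End Cellular.

Theorem theorem4p9 (X : mds) (hX : cellular X) (d : Iu -> X) (hd : continuous d) :
  Sp_dpath d <->
  exists (g : Iu -> X) (phi : Iu -> Iu),
    (mpaths X g \/ exists x : X, g = (fun _ => x)) /\ in_I1 phi /\ d = g \o phi.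
Proof.
split.
- move=> [[x ->]|[k [l [g [phi [k0 [l0 [l1 [hg hdg]]]]]]]]].
    by exists (fun=> x), id; split; [right; exists x|split=> //; exact: in_M11_id.1].
  have [W [Xs [f [c [X_mds [_ [_ [f_id [f_comp [colc [colf [bot att]]]]]]]]]]]] := hX.
  have bot' n : (forall m, ~ wlt m n) -> mstates (Xs n) = setT /\ mpaths (Xs n) = set0.
    by move=> nmin; have [_] := bot n nmin.
  have [g' [phi' [? ? ?]]] := traces_factor X_mds colc
    (moore_traces X_mds f_comp f_id colc colf bot' att l0 l1 hg hdg k0).
  by exists g', phi'; split; first by left.
- move=> [g [phi [[Xg|[x ->]] [Iphi ->]]]]; last by left; exists x.
  (* A single piece of length 1. *)
  right; exists 1%N, (fun=> 1), (fun=> g), (fun=> phi); split=> //; split=> //.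
  split; first by rewrite big_ord_recl big_ord0 addr0.
  split=> // -[|//] _ t s _; rewrite big_ord0 subr0 divr1 => /val_inj ->.
  by [].
Qed.
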